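(* Let $T$ be a continuous t-norm, let $(b_i)_{i\in\mathbb N}$ be positive numbers with $\sum_{i=1}^\infty b_i<+\infty$, and for each $i\in\mathbb N$ let $m_i\in M_{b_i}$ be $\tau_T$-superadditive. Let $(V_i,\nu^i,\tau_i,\tau_i^* )$, $i\in\mathbb N$, be PN spaces such that each $(V_i,\nu^im_i,\mathbf T,\mathbf T)$ is a (proper) PN space, where $(\nu^im_i)(p_i):=\nu^i_{p_i}m_i$, and let $(V,G)$ be their $\mathbf T$-product: $V=\prod_{i=1}^\infty V_i$ and $G_{\bar p}:=\mathbf T^\infty(\nu^i_{p_i}m_i)$ for $\bar p=(p_i)\in V$. Let each $V_i$ be endowed with the strong topology corresponding to $\nu^i$, and $\Delta^+$ with the topology of weak convergence. Then the product topology on $V$ is weaker (i.e. coarser, not necessarily strictly) than the strong topology on $(V,G)$.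
   Context: $\Delta^+$ is the set of distance distribution functions: nondecreasing $F:[0,+\infty]\to[0,1]$ with $F(0)=0$, $F(+\infty)=1$, left-continuous on $(0,+\infty)$, ordered pointwise. $\epsilon_a$ is the unit step at $a\ge0$: $0$ on $[0,a]$ and $1$ on $]a,+\infty]$. A triangle function is a binary operation on $\Delta^+$ that is commutative, associative, nondecreasing in each argument and has $\epsilon_0$ as identity; continuity refers to weak convergence. A t-norm is a commutative, associative operation on $[0,1]$, nondecreasing in each variable, with identity $1$; $\tau_T(F,G)(x)=\sup_{s+t=x}T(F(s),G(t))$ and $\mathbf T(F,G)(x)=T(F(x),G(x))$. A PN space is a quadruple $(V,\nu,\tau,\tau^* )$ where $V$ is a real linear space with null vector $\theta$, $\tau,\tau^*$ are continuous triangle functions with $\tau\le\tau^*$, and $\nu:V\to\Delta^+$, $p\mapsto\nu_p$, satisfies: (N1) $\nu_p=\epsilon_0$ iff $p=\theta$; (N2) $\nu_{-p}=\nu_p$; (N3) $\nu_{p+q}\ge\tau(\nu_p,\nu_q)$; (N4) $\nu_p\le\tau^*(\nu_{\alpha p},\nu_{(1-\alpha)p})$ for all $\alpha\in[0,1]$; for all $p,q\in V$. It is proper if $\tau(\epsilon_s,\epsilon_t)\ge\epsilon_{s+t}$ for all $s,t\ge0$ (automatic for $\tau=\mathbf T$). The strong topology of a PN space $(V,\nu,\tau,\tau^* )$ is the one determined by the neighborhoods $N_p(t)=\{q\in V:\nu_{q-p}(t)>1-t\}$, $p\in V$, $t>0$. The pair $(V,G)$ above is a PN space under $\mathbf T,\mathbf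 T$, and its strong topology is given by $N_{\bar p}(t)=\{\bar q\in V:G_{\bar q-\bar p}(t)>1-t\}$. For $0<b<+\infty$, $M_b$ is the set of continuous strictly increasing functions $m$ from $[0,b]$ onto $[0,+\infty]$. For $F\in\Delta^+$ and $m\in M_b$: $(Fm)(x)=F(m(x))$ for $x\in[0,b[$, $(Fm)(b)=\lim_{x\to b^-}F(m(x))$, $(Fm)(x)=1$ for $x>b$. The function $m$ is $\tau_T$-superadditive if $\tau_T(F,G)m\ge\tau_T(Fm,Gm)$ for all $F,G\in\Delta^+$. For a sequence $(F_n)$ in $\Delta^+$, let $T^1=T$, $T^{n+1}(x_1,\dots,x_{n+2})=T(T^n(x_1,\dots,x_{n+1}),x_{n+2})$; $\mathbf T^\infty F_n\in\Delta^+$ is the left-continuous regularization on $(0,+\infty)$ (with value $0$ at $0$ and $1$ at $+\infty$), i.e. the left limit, of the function $x\mapsto\lim_{n\to\infty}T^n(F_1(x),\dots,F_{n+1}(x))$. *)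

(* Defs.v *)
From HB Require Import structures.
From mathcomp Require Import all_boot all_order all_algebra.
From mathcomp Require Import all_classical all_reals all_analysis.
Import Order.TTheory GRing.Theory Num.Theory.
Import numFieldNormedType.Exports.

Set Implicit Arguments.
Unset Strict Implicit.
Unset Printing Implicit Defensive.

Local Open Scope classical_set_scope.
Local Open Scope ring_scope.

Section left_limits.
Context {R : realType}.
Implicit Types (g : R -> R) (x c : R).

Lemma nondecreasing_cvg_at_left g x c :
  (forall y z, y <= z -> z < x -> g y <= g z) ->
  (forall y, y < x -> g y <= c) ->
  (forall e, 0 < e -> exists2 y, y < x & c - e < g y) ->
  g y @[y --> x^'-] --> c.
Proof.
move=> ndg gc gapx; apply/cvgrPdist_lt => e e0.
have [y yx cy] := gapx e e0.
near=> z.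
have zx : z < x by near: z; exact: nbhs_left_lt.
have yz : y < z by near: z; exact: nbhs_left_gt.
rewrite ger0_norm ?subr_ge0 ?gc// ltrBlDr -ltrBlDl.
by rewrite (lt_le_trans cy)// ndg// ltW.
Unshelve. all: by end_near. Qed.

Lemma nondecreasing_ge_at_left g x c y :
  (forall y z, y <= z -> z < x -> g y <= g z) ->
  g y @[y --> x^'-] --> c -> y < x -> g y <= c.
Proof.
move=> ndg gc yx; apply: (cvgr_to_ge gc).
near=> z; apply: ndg; last by near: z; exact: nbhs_left_lt.
by apply/ltW; near: z; exact: nbhs_left_gt.
Unshelve. all: by end_near. Qed.

Lemma cvg_at_left_approx g x c e :
  g y @[y --> x^'-] --> c -> 0 < e ->
  exists2 y, y < x & c - e < g y.
Proof.
move=> /cvgrPdist_lt gc e0.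
near x^'- => y; exists y; first by near: y; exact: nbhs_left_lt.
suff : `|c - g y| < e by rewrite ltr_norml => /andP[_]; rewrite ltrBlDr -ltrBlDl.
by near: y; exact: gc.
Unshelve. all: by end_near. Qed.

Lemma nondecreasing_is_cvg_at_left g x c :
  (forall y z, y <= z -> z < x -> g y <= g z) ->
  (forall y, y < x -> g y <= c) ->
  cvg (g y @[y --> x^'-]).
Proof.
move=> ndg gc; apply: nondecreasing_at_left_is_cvgr.
  apply: nearW => z u v; rewrite !in_itv/= => /andP[_ ux] /andP[_ vx] uv.
  exact: ndg.
apply: nearW => z; exists c => _ /= [u + <-].
by rewrite in_itv/= => /andP[_ ux]; exact: gc.
Qed.

End left_limits.

Section distance_distribution_functions.
Context {R : realType}.

(* A function on [0, +oo] is encoded by its extension by 0 to [-oo, 0[. This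
   makes equality of distance distribution functions extensional equality on
   [0, +oo]. Left-continuity is required at the points of ]0, +oo[ only, so a
   jump at +oo is allowed. *)
Record is_ddf (F : \bar R -> R) : Prop := IsDdf {
  ddf_itv : forall x, 0 <= F x <= 1 ;
  ddf_homo : forall x y, (x <= y)%E -> F x <= F y ;
  ddf_le0 : forall x, (x <= 0)%E -> F x = 0 ;
  ddf_pinfty : F +oo%E = 1 ;
  ddf_left_continuous :
    forall x : R, 0 < x -> F y%:E @[y --> x^'-] --> F x%:E }.

Record ddf := Ddf { ddf_fun :> \bar R -> R ; ddfP : is_ddf ddf_fun }.

Lemma ddf_eqP (F G : ddf) : (F : \bar R -> R) =1 G -> F = G.
Proof.
case: F G => [F hF] [G hG] /= /funext FG.
by subst G; congr Ddf; exact: Prop_irrelevance.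
Qed.

Definition ddf_le (F G : ddf) := forall x : \bar R, F x <= G x.

Definition unit_step_fun (a : R) (x : \bar R) : R :=
  if (x <= a%:E)%E then 0 else 1.

Lemma unit_step_is_ddf (a : {nonneg R}) : is_ddf (unit_step_fun a%:num).
Proof.
rewrite /unit_step_fun; split.
- by move=> x; case: ifPn; rewrite ?lexx ler01.
- move=> x y xy; case: ifPn; case: ifPn => // ya xa; last first.
    by rewrite (le_trans xy ya) in xa.
- by move=> x x0; rewrite ifT// (le_trans x0)// lee_fin.
- by rewrite leye_eq.
- move=> x x0; case: ifPn => [xa|xa].
    apply: cvg_near_cst; near=> y; rewrite ifT// lee_fin.
    rewrite lee_fin in xa; apply: le_trans xa.
    by apply/ltW; near: y; exact: nbhs_left_lt.
  apply: cvg_near_cst; near=> y; rewrite ifF//.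
  apply/negbTE; rewrite -ltNge lte_fin; near: y; apply: nbhs_left_gt.
  by rewrite -ltNge lte_fin in xa.
Unshelve. all: by end_near. Qed.

Definition unit_step (a : {nonneg R}) : ddf := Ddf (unit_step_is_ddf a).

Definition weak_cvg (F_ : nat -> ddf) (F : ddf) :=
  forall x : R, 0 < x -> F y%:E @[y --> x] --> F x%:E ->
    F_ n x%:E @[n --> \oo] --> F x%:E.

(* Weak convergence is metrizable, hence sequential continuity is continuity
   for the topology of weak convergence. *)
Definition weakly_continuous (tau : ddf -> ddf -> ddf) :=
  forall (F_ G_ : nat -> ddf) (F G : ddf),
    weak_cvg F_ F -> weak_cvg G_ G ->
    weak_cvg (fun n => tau (F_ n) (G_ n)) (tau F G).

Record triangle_function (tau : ddf -> ddf -> ddf) : Prop := TriangleFunction {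
  triangleC : commutative tau ;
  triangleA : associative tau ;
  triangle_le : forall F F' G G',
    ddf_le F F' -> ddf_le G G' -> ddf_le (tau F G) (tau F' G') ;
  triangle_id : left_id (unit_step 0%:nng) tau }.

Definition proper_triangle (tau : ddf -> ddf -> ddf) :=
  forall s t : {nonneg R},
    ddf_le (unit_step (s%:num + t%:num)%:nng) (tau (unit_step s) (unit_step t)).

End distance_distribution_functions.
Arguments ddf : clear implicits.

Section t_norms.
Context {R : realType}.

Record is_tnorm (T : R -> R -> R) : Prop := IsTnorm {
  tnorm_itv : {in `[0, 1] &, forall x y, T x y \in `[0, 1]} ;
  tnormC : {in `[0, 1] &, commutative T} ;
  tnormA : {in `[0, 1] & &, associative T} ;
  tnorm_le : forall x x' y y', x \in `[0, 1] -> x' \in `[0, 1] ->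
    y \in `[0, 1] -> y' \in `[0, 1] ->
    x <= x' -> y <= y' -> T x y <= T x' y' ;
  tnorm1 : {in `[0, 1], right_id 1 T} }.

Record continuous_tnorm := ContinuousTnorm {
  tnorm_fun :> R -> R -> R ;
  tnormP : is_tnorm tnorm_fun ;
  tnorm_continuous : {within `[0, 1]%classic `*` `[0, 1]%classic,
    continuous (fun xy : R * R => tnorm_fun xy.1 xy.2)} }.

Definition tauT (T : R -> R -> R) (F G : \bar R -> R) (x : \bar R) : R :=
  sup [set T (F st.1) (G st.2) | st in
        [set st : \bar R * \bar R | [/\ 0 <= st.1, 0 <= st.2 & st.1 + st.2 = x]%E]].

Lemma ddf_in01 (F : ddf R) x : F x \in `[0, 1].
Proof. by rewrite in_itv/= (ddf_itv (ddfP F)). Qed.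

Lemma tnorm_le_l (T : R -> R -> R) x y : is_tnorm T ->
  x \in `[0, 1] -> y \in `[0, 1] -> T x y <= x.
Proof.
move=> hT x01 y01; rewrite -[leRHS](tnorm1 hT)//.
apply: (tnorm_le hT) => //; first by rewrite in_itv/= ler01 lexx.
by move: y01; rewrite in_itv/= => /andP[].
Qed.

Section pointwise.
Variables (T : continuous_tnorm) (F G : ddf R).
Let hT := tnormP T.
Let hF := ddfP F.
Let hG := ddfP G.

Lemma boldT_is_ddf : is_ddf (fun x => T (F x) (G x)).
Proof.
split.
- by move=> x; move: (tnorm_itv hT (ddf_in01 F x) (ddf_in01 G x)); rewrite in_itv.
- by move=> x y xy; apply: (tnorm_le hT); rewrite ?ddf_in01// ddf_homo.
- move=> x x0; apply/eqP; rewrite eq_le; apply/andP; split.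
    by rewrite -[leRHS](ddf_le0 hF x0) tnorm_le_l// ddf_in01.
  by move: (tnorm_itv hT (ddf_in01 F x) (ddf_in01 G x)); rewrite in_itv => /andP[].
- by rewrite (ddf_pinfty hF) (ddf_pinfty hG) (tnorm1 hT)// in_itv/= ler01 lexx.
- move=> x x0.
  have := @tnorm_continuous T.
  move=> /subspace_continuousP /(_ (F x%:E, G x%:E)) /=.
  have inE01 z (H : ddf R) : `[0, 1]%classic (H z) by exact: ddf_in01.
  move=> /(_ (conj (inE01 _ _) (inE01 _ _))) Tc.
  apply: (@cvg_comp _ _ _ (fun y : R => (F y%:E, G y%:E))
    (fun xy => T xy.1 xy.2) _ _ _ _ Tc) => A.
  rewrite /within/= => -[[/= B C] [/= FB GC] BCA].
  have FB' : \forall y \near x^'-, B (F y%:E) by exact: (ddf_left_continuous hF).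
  have GC' : \forall y \near x^'-, C (G y%:E) by exact: (ddf_left_continuous hG).
  near=> y; apply: (BCA (F y%:E, G y%:E)) => /=; last by rewrite !ddf_in01.
  by split; near: y.
Unshelve. all: by end_near. Qed.

End pointwise.

Definition boldT (T : continuous_tnorm) (F G : ddf R) : ddf R :=
  Ddf (boldT_is_ddf T F G).

(* With [x] indexed from 0, [iter_tnorm T x n] is T^n(x_1, ..., x_{n+1}). *)
Fixpoint iter_tnorm (T : R -> R -> R) (x : nat -> R) (n : nat) : R :=
  if n is n'.+1 then T (iter_tnorm T x n') (x n) else x 0.

Definition lim_tnorm (T : R -> R -> R) (F_ : nat -> ddf R) (x : \bar R) : R :=
  limn (iter_tnorm T (fun n => F_ n x)).

Definition Tinfty_fun (T : R -> R -> R) (F_ : nat -> ddf R) (x : \bar R) : R :=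
  match x with
  | -oo%E => 0
  | +oo%E => 1
  | r%:E => if r <= 0 then 0 else lim (lim_tnorm T F_ y%:E @[y --> r^'-])
  end.

Section infinite_iterate.
Variables (T : continuous_tnorm) (F_ : nat -> ddf R).
Let hT := tnormP T.
Let g := lim_tnorm T F_.

Lemma iter_tnorm_in01 n x : iter_tnorm T (fun n => F_ n x) n \in `[0, 1].
Proof.
by elim: n => [|n ih] /=; [exact: ddf_in01|apply: (tnorm_itv hT) => //; exact: ddf_in01].
Qed.

Lemma iter_tnorm_nonincreasing x :
  nonincreasing_seq (iter_tnorm T (fun n => F_ n x)).
Proof.
apply/nonincreasing_seqP => n /=.
by rewrite tnorm_le_l//; [exact: iter_tnorm_in01|exact: ddf_in01].
Qed.

Lemma iter_tnorm_is_cvg x : cvgn (iter_tnorm T (fun n => F_ n x)).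
Proof.
apply: nonincreasing_is_cvgn; first exact: iter_tnorm_nonincreasing.
by exists 0 => _ [n _ <-]; have := iter_tnorm_in01 n x; rewrite in_itv => /andP[].
Qed.

Lemma lim_tnorm_itv x : 0 <= g x <= 1.
Proof.
apply/andP; split.
  apply: limr_ge; first exact: iter_tnorm_is_cvg.
  by near=> n; have := iter_tnorm_in01 n x; rewrite in_itv => /andP[].
apply: limr_le; first exact: iter_tnorm_is_cvg.
by near=> n; have := iter_tnorm_in01 n x; rewrite in_itv => /andP[].
Unshelve. all: by end_near. Qed.

Lemma lim_tnorm_homo x y : (x <= y)%E -> g x <= g y.
Proof.
move=> xy; apply: ler_lim; [exact: iter_tnorm_is_cvg..|].
apply: nearW; elim=> [|n ih] /=; first exact: (ddf_homo (ddfP _)).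
apply: (tnorm_le hT) => //; rewrite ?iter_tnorm_in01 ?ddf_in01//.
exact: (ddf_homo (ddfP _)).
Qed.

Lemma lim_tnorm_left_cvg (x : R) :
  g y%:E @[y --> x^'-] --> lim (g y%:E @[y --> x^'-]).
Proof.
apply: (@nondecreasing_is_cvg_at_left _ (fun y => g y%:E) x 1).
  by move=> y z yz _; apply: lim_tnorm_homo; rewrite lee_fin.
by move=> y _; have /andP[] := lim_tnorm_itv y%:E.
Qed.

Lemma lim_tnorm_le_left (y x : R) : y < x ->
  g y%:E <= lim (g y%:E @[y --> x^'-]).
Proof.
apply: (@nondecreasing_ge_at_left _ (fun y => g y%:E)).
  by move=> u z uz _; apply: lim_tnorm_homo; rewrite lee_fin.
exact: lim_tnorm_left_cvg.
Qed.

Lemma left_lim_tnorm_le (x c : R) : (forall y, y < x -> g y%:E <= c) ->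
  lim (g y%:E @[y --> x^'-]) <= c.
Proof.
move=> h; apply: limr_le; first exact: lim_tnorm_left_cvg.
by near=> y; apply: h; near: y; exact: nbhs_left_lt.
Unshelve. all: by end_near. Qed.

Lemma left_lim_tnorm_homo (x y : R) : x <= y ->
  lim (g z%:E @[z --> x^'-]) <= lim (g z%:E @[z --> y^'-]).
Proof.
move=> xy; apply: left_lim_tnorm_le => z zx; apply: lim_tnorm_le_left.
exact: lt_le_trans zx xy.
Qed.

Lemma Tinfty_is_ddf : is_ddf (Tinfty_fun T F_).
Proof.
have itv : forall x, 0 <= Tinfty_fun T F_ x <= 1.
  case=> [r| |] /=; rewrite ?lexx ?ler01//.
  case: ifPn => r0; rewrite ?lexx ?ler01//.
  apply/andP; split.
    apply: (le_trans _ (@lim_tnorm_le_left (r - 1) r _)); last by rewrite ltrBlDr ltrDl.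
    by have /andP[] := lim_tnorm_itv (r - 1)%:E.
  by apply: left_lim_tnorm_le => y _; have /andP[] := lim_tnorm_itv y%:E.
have homo : forall x y, (x <= y)%E -> Tinfty_fun T F_ x <= Tinfty_fun T F_ y.
  case=> [r| |] [s| |] //.
  - rewrite lee_fin => rs /=.
    case: ifPn => r0; last first.
      rewrite ifF; first exact: left_lim_tnorm_homo.
        by move: r0; rewrite -ltNge => r0; apply/negbTE; rewrite -ltNge (lt_le_trans r0 rs).
    by have /andP[] := itv s%:E.
  - by move=> _; have /andP[] := itv r%:E.
  - by move=> _; have /andP[] := itv s%:E.
split => //.
- case=> [r| |] //=; first by rewrite lee_fin => ->.
- move=> x x0; apply: nondecreasing_cvg_at_left.
  + by move=> y z yz _; apply: homo; rewrite lee_fin.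
  + by move=> y yx; apply: homo; rewrite lee_fin ltW.
  + move=> e e0; rewrite /= leNgt x0 /=.
    have [z zx ze] := cvg_at_left_approx (lim_tnorm_left_cvg (x:=x)) e0.
    pose w := Num.max z 0.
    have wx : w < x by rewrite /w gt_max zx.
    exists ((w + x) / 2); first by rewrite midf_lt.
    have wm : w < (w + x) / 2 by rewrite midf_lt.
    rewrite ifF; last first.
      by apply/negbTE; rewrite -ltNge (le_lt_trans _ wm)// /w le_max lexx orbT.
    apply: (lt_le_trans ze); apply: lim_tnorm_le_left.
    by rewrite (le_lt_trans _ wm)// /w le_max lexx.
Qed.

End infinite_iterate.

Definition Tinfty (T : continuous_tnorm) (F_ : nat -> ddf R) : ddf R :=
  Ddf (Tinfty_is_ddf T F_).

End t_norms.
Arguments continuous_tnorm : clear implicits.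

Section change_of_scale.
Context {R : realType}.

Record is_M (b : R) (m : R -> \bar R) : Prop := IsM {
  M_continuous : {within `[0, b], continuous m} ;
  M_increasing : {in `[0, b] &, forall x y, x < y -> (m x < m y)%E} ;
  M_onto : m @` `[0, b] = [set y | (0 <= y)%E] }.

Record M (b : R) := MkM { M_fun :> R -> \bar R ; MP : is_M b M_fun }.

Definition rescale_fun (b : R) (F : \bar R -> R) (m : R -> \bar R)
    (x : \bar R) : R :=
  match x with
  | -oo%E => 0
  | +oo%E => 1
  | r%:E => if r < 0 then 0
            else if r < b then F (m r)
            else if r == b then lim (F (m y) @[y --> b^'-])
            else 1
  end.

Section rescale.
Variables (b : R) (F : ddf R) (m : M b).
Let hm := MP m.
Let hF := ddfP F.

Lemma M_homo x y : 0 <= x -> y <= b -> x <= y -> (m x <= m y)%E.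
Proof.
move=> x0 yb; rewrite le_eqVlt => /predU1P[->//|xy]; apply/ltW.
apply: (M_increasing hm) => //; rewrite in_itv/=.
  by rewrite x0 (le_trans (ltW xy)).
by rewrite yb (le_trans x0 (ltW xy)).
Qed.

Lemma M_surj y : (0 <= y)%E -> exists2 x, 0 <= x <= b & m x = y.
Proof.
move=> y0; have : [set y | (0 <= y)%E] y by [].
by rewrite -(M_onto hm) => -[x]; rewrite /= in_itv/= => x0b mx; exists x.
Qed.

Lemma M_gt0 : 0 < b.
Proof.
have [x /andP[x0 xb] mx] := M_surj (lexx 0%E).
have [y /andP[y0 yb] my] := M_surj (leey 0%E).
rewrite lt_neqAle (le_trans x0 xb) andbT; apply/eqP => b0.
have xE : x = 0 by apply/eqP; rewrite eq_le x0 andbT b0.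
have yE : y = 0 by apply/eqP; rewrite eq_le y0 andbT b0.
by move: mx; rewrite xE -yE my.
Qed.

Lemma M_ge0 x : 0 <= x -> x <= b -> (0 <= m x)%E.
Proof.
move=> x0 xb; have : (m @` `[0, b]) (m x) by exists x; rewrite //= in_itv/= x0.
by rewrite (M_onto hm).
Qed.

Lemma M0 : m 0 = 0%E.
Proof.
have [x /andP[x0 xb] mx] := M_surj (lexx 0%E).
apply/eqP; rewrite eq_le (M_ge0 (lexx 0) (ltW M_gt0)) andbT.
by rewrite -mx; apply: M_homo.
Qed.

Lemma rescale_near_b :
  \forall y \near b^'-, F (m y) = rescale_fun b F m y%:E.
Proof.
near=> y; apply/esym; rewrite /= ifF; last first.
  by apply/negbTE; rewrite -leNgt ltW//; near: y; apply: nbhs_left_gt; exact: M_gt0.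
by rewrite ifT//; near: y; exact: nbhs_left_lt.
Unshelve. all: by end_near. Qed.

Lemma rescale_itv_neq r : r != b -> 0 <= rescale_fun b F m r%:E <= 1.
Proof.
move=> rb; rewrite /= (negbTE rb).
case: ifPn => _; rewrite ?lexx ?ler01//.
case: ifPn => _; rewrite ?lexx ?ler01//.
exact: ddf_itv.
Qed.

Lemma rescale_homo_ltb y z : y <= z -> z < b ->
  rescale_fun b F m y%:E <= rescale_fun b F m z%:E.
Proof.
move=> yz zb; have /andP[z0 _] := rescale_itv_neq (negbT (lt_eqF zb)).
have yb : y < b := le_lt_trans yz zb.
have [yn|y0] := ltP y 0.
  by rewrite [leLHS]/= yn.
rewrite /= !ltNge y0 (le_trans y0 yz) /= -!ltNge yb zb.
by apply: (ddf_homo hF); rewrite M_homo// ltW.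
Qed.

Lemma rescale_lim :
  rescale_fun b F m y%:E @[y --> b^'-] --> rescale_fun b F m b%:E.
Proof.
have cv : cvg (rescale_fun b F m y%:E @[y --> b^'-]).
  apply: (@nondecreasing_is_cvg_at_left _ (fun y => rescale_fun b F m y%:E) b 1).
    exact: rescale_homo_ltb.
  by move=> y yb; have /andP[] := rescale_itv_neq (negbT (lt_eqF yb)).
have -> : rescale_fun b F m b%:E = lim (F (m y) @[y --> b^'-]).
  by rewrite /= ltNge (ltW M_gt0) /= ltxx eqxx.
suff vlim : F (m y) @[y --> b^'-] --> lim (rescale_fun b F m y%:E @[y --> b^'-]).
  by rewrite (cvg_lim _ vlim).
apply: cvg_trans cv; apply: near_eq_cvg.
by apply: filterS rescale_near_b => y ->.
Qed.

Lemma rescale_is_ddf : is_ddf (rescale_fun b F m).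
Proof.
have itvb : 0 <= rescale_fun b F m b%:E <= 1.
  apply/andP; split.
    apply: (cvgr_to_ge rescale_lim); near=> y.
    have yb : y < b by near: y; exact: nbhs_left_lt.
    by have /andP[] := rescale_itv_neq (negbT (lt_eqF yb)).
  apply: (cvgr_to_le rescale_lim); near=> y.
  have yb : y < b by near: y; exact: nbhs_left_lt.
  by have /andP[] := rescale_itv_neq (negbT (lt_eqF yb)).
have itv : forall x, 0 <= rescale_fun b F m x <= 1.
  case=> [r| |]; rewrite ?lexx ?ler01//.
  by have [->//|rb] := eqVneq r b; exact: rescale_itv_neq.
have gtb r : b < r -> rescale_fun b F m r%:E = 1.
  move=> br; rewrite /= !ltNge (ltW (lt_trans M_gt0 br)) (ltW br) /=.
  by rewrite gt_eqF.
have homo : forall x y, (x <= y)%E -> rescale_fun b F m x <= rescale_fun b F m y.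
  case=> [r| |] [s| |] //.
  - rewrite lee_fin => rs.
    have [sb|bs|sb] := ltgtP s b; first exact: rescale_homo_ltb.
      by rewrite (gtb _ bs); have /andP[] := itv r%:E.
    rewrite sb in rs *; move: rs; rewrite le_eqVlt => /predU1P[->//|rb].
    exact: (nondecreasing_ge_at_left rescale_homo_ltb rescale_lim).
  - by move=> _; have /andP[] := itv r%:E.
  - by move=> _; have /andP[] := itv s%:E.
split => //.
- case=> [r| |] //; rewrite lee_fin le_eqVlt => /predU1P[->|/= ->//].
  by rewrite /= ltxx M_gt0 M0 (ddf_le0 hF).
- move=> x x0; have [xb|bx|->] := ltgtP x b; last exact: rescale_lim.
    apply: nondecreasing_cvg_at_left.
    + by move=> y z yz _; apply: homo; rewrite lee_fin.
    + by move=> y yx; apply: homo; rewrite lee_fin ltW.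
    + move=> e e0.
      have mx0 : (0 < m x)%E.
        by rewrite -M0 (M_increasing hm)// in_itv/= ?lexx ?(ltW M_gt0) ?(ltW x0) ?(ltW xb).
      have mxy : (m x < +oo)%E.
        apply: (@lt_le_trans _ _ (m b)); last exact: leey.
        by rewrite (M_increasing hm)// in_itv/= ?lexx ?(ltW M_gt0) ?(ltW x0) ?(ltW xb).
      have Ex : rescale_fun b F m x%:E = F (m x) by rewrite /= ltNge (ltW x0) /= xb.
      rewrite Ex; case mxE : (m x) mx0 mxy => [s| |]// + _.
      rewrite lte_fin => s0.
      have [t ts te] := cvg_at_left_approx (ddf_left_continuous hF s0) e0.
      pose w := Num.max t 0.
      have ws : w < s by rewrite /w gt_max ts.
      have w0 : (0 <= w%:E)%E by rewrite lee_fin /w le_max lexx orbT.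
      have [y /andP[y0 yb] my] := M_surj w0.
      have yx : y < x.
        rewrite ltNge; apply/negP => xy.
        by have := M_homo (ltW x0) yb xy; rewrite my mxE lee_fin leNgt ws.
      exists y => //; have -> : rescale_fun b F m y%:E = F w%:E.
        by rewrite /= ltNge y0 /= (lt_trans yx xb) my.
      apply: (lt_le_trans te); apply: (ddf_homo hF).
      by rewrite lee_fin /w le_max lexx.
  rewrite (gtb _ bx); apply: cvg_near_cst; near=> y; apply: gtb.
  by near: y; exact: nbhs_left_gt.
Unshelve. all: by end_near. Qed.

End rescale.

Definition rescale (b : R) (F : ddf R) (m : M b) : ddf R :=
  Ddf (rescale_is_ddf F m).

Definition tauT_superadditive (T : R -> R -> R) (b : R) (m : M b) :=
  forall (F G : ddf R) (x : \bar R), (0 <= x)%E ->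
    tauT T (rescale F m) (rescale G m) x <= rescale_fun b (tauT T F G) m x.

End change_of_scale.

Section pn_spaces.
Context {R : realType}.

Record pn_space (V : lmodType R) (nu : V -> ddf R)
    (tau tau' : ddf R -> ddf R -> ddf R) : Prop := PNSpace {
  pn_triangle : triangle_function tau ;
  pn_triangle' : triangle_function tau' ;
  pn_continuous : weakly_continuous tau ;
  pn_continuous' : weakly_continuous tau' ;
  pn_tau_le : forall F G, ddf_le (tau F G) (tau' F G) ;
  pn_N1 : forall p, nu p = unit_step 0%:nng <-> p = 0 ;
  pn_N2 : forall p, nu (- p) = nu p ;
  pn_N3 : forall p q, ddf_le (tau (nu p) (nu q)) (nu (p + q)) ;
  pn_N4 : forall (p : V) (a : R), 0 <= a <= 1 ->
    ddf_le (nu p) (tau' (nu (a *: p)) (nu ((1 - a) *: p))) }.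

Record proper_pn_space (V : lmodType R) (nu : V -> ddf R)
    (tau tau' : ddf R -> ddf R -> ddf R) : Prop := ProperPNSpace {
  proper_pn : pn_space nu tau tau' ;
  proper_tau : proper_triangle tau }.

Definition strong_nbhd (V : zmodType) (nu : V -> ddf R) (p : V) (t : R) : set V :=
  [set q | 1 - t < nu (q - p) t%:E].

Definition strong_space (V : zmodType) (nu : V -> ddf R) : Type := V.

Section strong_topology.
Variables (V : zmodType) (nu : V -> ddf R).
Local Notation S := (strong_space nu).

Definition strong_open : set_system S :=
  [set A | forall p, A p -> exists2 t : R, 0 < t & strong_nbhd nu p t `<=` A].

Lemma strong_nbhd_le p s t : s <= t -> strong_nbhd nu p s `<=` strong_nbhd nu p t.
Proof.
move=> st q; rewrite /strong_nbhd/= => sq.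
rewrite (le_lt_trans _ (lt_le_trans sq _)) ?lerD2l ?lerN2//.
by apply: (ddf_homo (ddfP _)); rewrite lee_fin.
Qed.

Let strong_openT : strong_open setT.
Proof. by move=> p _; exists 1. Qed.

Let strong_openI : setI_closed strong_open.
Proof.
move=> A B oA oB p [/oA[s s0 sA] /oB[t t0 tB]].
exists (Num.min s t); first by rewrite lt_min s0.
by move=> q qst; split; [apply: sA|apply: tB];
  apply: strong_nbhd_le qst; rewrite ge_min lexx ?orbT.
Qed.

Let strong_open_bigU (I : Type) (f : I -> set S) :
  (forall i, strong_open (f i)) -> strong_open (\bigcup_i f i).
Proof.
move=> fo p [i _ /(fo i)[t t0 tf]]; exists t => //.
by apply: subset_trans tf _; exact: bigcup_sup.
Qed.

HB.instance Definition _ := Choice.on S.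
HB.instance Definition _ :=
  isOpenTopological.Build S strong_openT strong_openI strong_open_bigU.

End strong_topology.

Section strong_nbhs.
Variables (V : lmodType R) (nu : V -> ddf R) (tau tau' : ddf R -> ddf R -> ddf R).
Hypothesis pn : pn_space nu tau tau'.

Lemma pn_nu0 : nu 0 = unit_step 0%:nng.
Proof. by apply/(pn_N1 pn). Qed.

Lemma strong_nbhd_center p t : 0 < t -> strong_nbhd nu p t p.
Proof.
move=> t0; rewrite /strong_nbhd/= subrr pn_nu0 /= /unit_step_fun lee_fin.
by rewrite leNgt t0 /= ltrBlDr ltrDl.
Qed.

Lemma weak_cvg_strong (p_ : nat -> V) :
  (forall n, 1 - n.+1%:R^-1 < nu (p_ n) (n.+1%:R^-1)%:E) ->
  weak_cvg (fun n => nu (p_ n)) (unit_step 0%:nng).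
Proof.
move=> hp x x0 _; rewrite /= /unit_step_fun lee_fin leNgt x0 /=.
apply/cvgrPdist_lt => e e0; near=> n.
have nx : n.+1%:R^-1 <= x.
  rewrite ltW//; near: n; exact: (near_infty_natSinv_lt (PosNum x0)).
have ne : n.+1%:R^-1 < e by near: n; exact: (near_infty_natSinv_lt (PosNum e0)).
rewrite ger0_norm ?subr_ge0; last by case/andP: (ddf_itv (ddfP (nu (p_ n))) x%:E).
rewrite ltrBlDr -ltrBlDl.
apply: le_lt_trans (lt_le_trans (hp n) _); first by rewrite lerD2l lerN2 ltW.
by apply: (ddf_homo (ddfP _)); rewrite lee_fin.
Unshelve. all: by end_near. Qed.

Lemma strong_nbhd_add s : 0 < s -> exists2 d, 0 < d &
  forall p q, 1 - d < nu p d%:E -> 1 - d < nu q d%:E -> 1 - s < nu (p + q) s%:E.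
Proof.
move=> s0; apply: contrapT => h.
have h' n : exists pq : V * V, [/\ 1 - n.+1%:R^-1 < nu pq.1 (n.+1%:R^-1)%:E,
    1 - n.+1%:R^-1 < nu pq.2 (n.+1%:R^-1)%:E & nu (pq.1 + pq.2) s%:E <= 1 - s].
  apply: contrapT => hn; apply: h; exists n.+1%:R^-1; first by rewrite invr_gt0.
  move=> p q hp hq; rewrite ltNge; apply/negP => hpq.
  by apply: hn; exists (p, q).
have [f fP] := choice h'.
have f1 n : 1 - n.+1%:R^-1 < nu (f n).1 (n.+1%:R^-1)%:E by have [] := fP n.
have f2 n : 1 - n.+1%:R^-1 < nu (f n).2 (n.+1%:R^-1)%:E by have [] := fP n.
have := pn_continuous pn (weak_cvg_strong f1) (weak_cvg_strong f2).
rewrite (triangle_id (pn_triangle pn)) => /(_ s s0) H.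
have {}H : tau (nu (f n).1) (nu (f n).2) s%:E @[n --> \oo] --> (1 : R).
  have -> : (1 : R) = unit_step (R := R) 0%:nng s%:E.
    by rewrite /= /unit_step_fun lee_fin leNgt s0.
  apply: H.
    rewrite /= /unit_step_fun lee_fin [_ <= 0]leNgt s0 /=.
    apply: cvg_near_cst; near=> y; rewrite lee_fin ifF//.
    by apply/negbTE; rewrite -ltNge; near: y; exact: lt_nbhsr.
have : (1 : R) <= 1 - s.
  apply: (cvgr_to_le H); near=> n; have [_ _ ] := fP n.
  by apply: le_trans; exact: (pn_N3 pn).
by rewrite leNgt ltrBlDr ltrDl s0.
Unshelve. all: by end_near. Qed.

Lemma strong_nbhsP (p : strong_space nu) (A : set (strong_space nu)) :
  nbhs p A <-> exists2 t, 0 < t & strong_nbhd nu p t `<=` A.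
Proof.
split=> [[B [oB Bp BA]]|[t t0 tA]].
  by have [t t0 tB] := oB _ Bp; exists t => //; exact: subset_trans BA.
exists [set q | exists2 s, 0 < s & strong_nbhd nu q s `<=` A]; split.
- move=> q [s s0 sA]; have [d d0 dP] := strong_nbhd_add s0.
  exists d => // r qr; exists d => // u ru; apply: sA.
  have -> : strong_nbhd nu q s u = (1 - s < nu ((r - q) + (u - r)) s%:E) :> Prop.
    by rewrite [_ + (u - r)]addrC subrKA.
  exact: dP.
- by exists t.
- by move=> q [s s0]; apply; exact: strong_nbhd_center.
Qed.

End strong_nbhs.

End pn_spaces.

Definition prod_lmod (R : pzRingType) (I : Type) (V : I -> lmodType R) : Type :=
  forall i, V i.

Section prod_lmod.
Variables (R : pzRingType) (I : Type) (V : I -> lmodType R).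
Local Notation P := (prod_lmod V).

Let add (p q : P) : P := fun i => p i + q i.
Let opp (p : P) : P := fun i => - p i.
Let scale (a : R) (p : P) : P := fun i => a *: p i.

Let addA : associative add.
Proof. by move=> p q r; apply: functional_extensionality_dep => i; exact: addrA. Qed.
Let addC : commutative add.
Proof. by move=> p q; apply: functional_extensionality_dep => i; exact: addrC. Qed.
Let add0 : left_id ((fun=> 0) : P) add.
Proof. by move=> p; apply: functional_extensionality_dep => i; exact: add0r. Qed.
Let addN : left_inverse ((fun=> 0) : P) opp add.
Proof. by move=> p; apply: functional_extensionality_dep => i; exact: addNr. Qed.

HB.instance Definition _ := Choice.on P.
HB.instance Definition _ := GRing.isZmodule.Build P addA addC add0 addN.

Let scaleA a c (p : P) : scale a (scale c p) = scale (a * c) p.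
Proof. by apply: functional_extensionality_dep => i; exact: scalerA. Qed.
Let scale1 : left_id 1 scale.
Proof. by move=> p; apply: functional_extensionality_dep => i; exact: scale1r. Qed.
Let scaleDr : right_distributive scale +%R.
Proof. by move=> a p q; apply: functional_extensionality_dep => i; exact: scalerDr. Qed.
Let scaleDl (p : P) : {morph scale^~ p : a c / a + c}.
Proof. by move=> a c; apply: functional_extensionality_dep => i; exact: scalerDl. Qed.

HB.instance Definition _ :=
  GRing.Zmodule_isLmodule.Build R P scaleA scale1 scaleDr scaleDl.

End prod_lmod.

Definition T_product (R : realType) (T : continuous_tnorm R)
    (V : nat -> lmodType R) (nu : forall i, V i -> ddf R) :
    prod_lmod V -> ddf R :=
  fun p => Tinfty T (fun i => nu i (p i)).

(* Main.v *)
(* Since T <= min, G_p <= nu^i_{p_i} m_i pointwise, so every coordinate projection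
   is continuous for the strong topology of the rescaled norms; and m_i, being an
   increasing homeomorphism near 0, maps a small [0, s] into [0, t], so the
   rescaled norm has a strong topology at least as fine as that of nu^i. *)
Require Import Defs.
From HB Require Import structures.
From mathcomp Require Import all_boot all_order all_algebra.
From mathcomp Require Import all_classical all_reals all_analysis.
Import Order.TTheory GRing.Theory Num.Theory.
Import numFieldNormedType.Exports.

Set Implicit Arguments.
Unset Strict Implicit.
Unset Printing Implicit Defensive.

Local Open Scope classical_set_scope.
Local Open Scope ring_scope.

Section coordinates.
Context {R : realType}.

(** The last factor is moved to the front by commutativity, and [T] lies below its first
    argument. *)
Lemma iter_tnorm_le (T : R -> R -> R) (x : nat -> R) (n : nat) : is_tnorm T ->
  (forall k, x k \in `[0, 1]) -> iter_tnorm T x n <= x n.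
Proof.
move=> hT x01; case: n => [//|n] /=.
have x01' : iter_tnorm T x n \in `[0, 1].
  by elim: n => [|n ih] /=; [exact: x01|exact: (tnorm_itv hT)].
by rewrite (tnormC hT)// tnorm_le_l.
Qed.

(** The iterates decrease, so their limit lies below the [i]-th one, whose last factor is
    [F_ i x]. *)
Lemma lim_tnorm_le (T : continuous_tnorm R) (F_ : nat -> ddf R) i x :
  lim_tnorm T F_ x <= F_ i x.
Proof.
apply: (@le_trans _ _ (iter_tnorm T (fun n => F_ n x) i)).
  apply: nonincreasing_cvgn_ge; first exact: iter_tnorm_nonincreasing.
  exact: iter_tnorm_is_cvg.
by apply: iter_tnorm_le => [|k]; [exact: tnormP|exact: ddf_in01].
Qed.

Lemma Tinfty_le (T : continuous_tnorm R) (F_ : nat -> ddf R) i :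
  ddf_le (Tinfty T F_) (F_ i).
Proof.
case=> [r| |] /=; last 2 first.
- by rewrite (ddf_pinfty (ddfP _)).
- by rewrite (ddf_le0 (ddfP _)).
case: ifPn => _; first by have /andP[] := ddf_itv (ddfP (F_ i)) r%:E.
(* The left limit keeps the bound: for [y < r] the value at [y] is at most [F_ i y], hence at most
   [F_ i r]. *)
apply: left_lim_tnorm_le => y yr; apply: le_trans (lim_tnorm_le _ _ i _) _.
by apply: (ddf_homo (ddfP _)); rewrite lee_fin ltW.
Qed.

Lemma rescale_strong_nbhd (V : zmodType) (nu : V -> ddf R) (b : R) (m : M b)
    (t : R) : 0 < t -> exists2 s, 0 < s & forall p,
  strong_nbhd (fun q => rescale (nu q) m) p s `<=` strong_nbhd nu p t.
Proof.
move=> t0; have t0' : (0 <= t%:E)%E by rewrite lee_fin ltW.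
have [x /andP[x0 xb] mx] := M_surj m t0'.
have b0 := M_gt0 m.
have xgt0 : 0 < x.
  rewrite lt_neqAle x0 andbT; apply/eqP => x_eq0.
  by move: mx t0; rewrite -x_eq0 M0 => -[<-]; rewrite ltxx.
(* [s <= x] gives [m s <= m x = t]; [s <= t] gives [1 - t <= 1 - s]; [b / 2] keeps [s] below [b],
   where the rescaled function is just [F (m s)]. *)
pose s := Num.min (Num.min x t) (b / 2).
have s0 : 0 < s by rewrite !lt_min xgt0 t0 divr_gt0.
have sx : s <= x by rewrite !ge_min lexx.
have st : s <= t by rewrite !ge_min lexx orbT.
have sb : s < b.
  by rewrite (@le_lt_trans _ _ (b / 2)) ?ge_min ?lexx ?orbT// gtr_pMr// invf_lt1// ltr1n.
exists s => // p q; rewrite /strong_nbhd /= [s < 0]ltNge (ltW s0) /= sb => sq.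
apply: (@le_lt_trans _ _ (1 - s)); first by rewrite lerD2l lerN2.
apply: lt_le_trans sq _; apply: (ddf_homo (ddfP _)).
by rewrite -mx M_homo // ltW.
Qed.

Lemma T_product_proj_open (T : continuous_tnorm R) (V : nat -> lmodType R)
    (nu : forall i, V i -> ddf R) i (U : set (V i)) :
  @open (strong_space (nu i)) U ->
  @open (strong_space (T_product T nu)) [set p | U (p i)].
Proof.
move=> oU; suff : strong_open (nu := T_product T nu) [set p | U (p i)] by [].
move=> p /oU[t t0 tU]; exists t => // q pq; apply: tU.
(* The same radius [t] serves in the product, since [(q - p) i] computes to [q i - p i]. *)
exact: lt_le_trans pq (Tinfty_le T _ i t%:E).
Qed.

End coordinates.

Lemma strong_open_mono (R : realType) (V : zmodType) (nu nu' : V -> ddf R) :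
  (forall t, 0 < t -> exists2 s, 0 < s & forall p,
    strong_nbhd nu' p s `<=` strong_nbhd nu p t) ->
  forall A, @open (strong_space nu) A -> @open (strong_space nu') A.
Proof.
move=> h A oA; suff : strong_open (nu := nu') A by [].
move=> p /oA[t /h[s s0 st] tA]; exists s => //.
exact: subset_trans (st p) tA.
Qed.

(** The product topology is the supremum of the topologies induced by the coordinates, so continuity
    of [f] can be checked one coordinate at a time. *)
Lemma prod_topology_open_coarser (I : Type) (K : I -> topologicalType)
    (S : topologicalType) (f : S -> prod_topology K) :
  (forall i U, open U -> open [set x | U (f x i)]) ->
  forall A, open A -> open (f @^-1` A).
Proof.
move=> h A oA; rewrite openE => p Ap.
have : f @ p --> f p.
  apply/cvg_sup => i B [C [[U oU <-] Up] UB].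
  apply: (filterS _ (open_nbhs_nbhs (conj (h i U oU) Up))) => x Ux.
  exact: UB.
by apply; exact: open_nbhs_nbhs.
Qed.

Theorem theorem12 (R : realType) (T : continuous_tnorm R)
    (b : nat -> R) (b_gt0 : forall i, 0 < b i)
    (b_summable : (\sum_(0 <= i <oo) (b i)%:E < +oo)%E)
    (m : forall i, M (b i))
    (m_superadditive : forall i, tauT_superadditive T (m i))
    (V : nat -> lmodType R) (nu : forall i, V i -> ddf R)
    (tau tau' : nat -> ddf R -> ddf R -> ddf R)
    (V_pn : forall i, pn_space (nu i) (tau i) (tau' i))
    (V_rescaled_pn : forall i,
      proper_pn_space (fun p => rescale (nu i p) (m i)) (boldT T) (boldT T)) :
  let G : prod_lmod V -> ddf R :=
    T_product T (fun i (p : V i) => rescale (nu i p) (m i)) in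
  forall A : set (forall i, V i),
    @open (prod_topology (fun i => strong_space (nu i))) A ->
    @open (strong_space G) A.
Proof.
move=> G A oA.
(* Both topologies live on the same carrier, so their comparison is continuity of the identity. *)
apply: (@prod_topology_open_coarser nat (fun i => strong_space (nu i))
  (strong_space G) (fun p => p) _ A oA) => i U oU.
apply: (@T_product_proj_open _ T V (fun j q => rescale (nu j q) (m j))).
by apply: strong_open_mono oU => t; exact: rescale_strong_nbhd.
Qed.
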